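(* The group $U_C(\ell^2)$ of all unitary operators on $\ell^2$ of the form $\mathbb I+K$, where $K$ is a compact operator, equipped with the uniform operator (operator norm) topology, does not have property $(T)$.
   Context: Here $\ell^2$ is the separable infinite-dimensional Hilbert space. A strongly continuous unitary representation $\pi$ of a topological group $G$ has almost invariant vectors if for every $\varepsilon>0$ and every compact $K\subseteq G$ there is a unit vector $\xi$ with $\|\xi-\pi_g\xi\|<\varepsilon$ for all $g\in K$. $G$ has property $(T)$ if every strongly continuous unitary representation of $G$ having almost invariant vectors has an invariant unit vector. *)

(* Defs.v *)
From HB Require Import structures.
From mathcomp Require Import all_boot all_order all_algebra.
From mathcomp Require Import complex.
From mathcomp Require Import all_classical all_reals all_analysis.

Set Implicit Arguments.
Unset Strict Implicit.
Unset Printing Implicit Defensive.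

Import Order.TTheory GRing.Theory Num.Theory.
Import numFieldNormedType.Exports.

Local Open Scope classical_set_scope.
Local Open Scope ring_scope.
Local Open Scope complex_scope.

(* The inner product is linear in its first argument and conjugate-linear in
   the second one. *)
HB.mixin Record CompleteNormedModule_isHilbert (R : realType) H
    & CompleteNormedModule R[i] H := {
  inner : {dot H for (@Num.conj R[i])} ;
  inner_norm : forall x : H, `|x| ^+ 2 = inner x x
}.

#[short(type="hilbertType")]
HB.structure Definition Hilbert (R : realType) :=
  {H of CompleteNormedModule R[i] H & CompleteNormedModule_isHilbert R H}.

HB.mixin Record isTopologicalGroup G & Topological G & Group G := {
  mulg_continuous : continuous (fun z : G * G => (z.1 * z.2)%g) ;
  invg_continuous : continuous (fun x : G => (x^-1)%g)
}.

#[short(type="topologicalGroupType")]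
HB.structure Definition TopologicalGroup :=
  {G of Topological G & Group G & isTopologicalGroup G}.

Definition separable_space (T : topologicalType) :=
  exists2 D : set T, countable D & dense D.

Definition infinite_dimensional (K : fieldType) (V : lmodType K) :=
  ~ exists (n : nat) (e : 'I_n -> V),
      forall x : V, exists c : 'I_n -> K, x = \sum_(i < n) c i *: e i.

Section Operators.
Variables (R : realType) (H : hilbertType R).
Implicit Types (f u v : H -> H) (x y : H).

Definition unitary_operator u :=
  [/\ linear u,
      forall x y, inner (u x) (u y) = inner x y &
      forall y, exists x, u x = y].

Definition compact_operator f :=
  linear f /\ precompact (f @` [set x | `|x| <= 1]).

(* The library norm on a complex space takes its (real) values in R[i]. *)
Definition rnorm x : R := complex.Re `|x|.

Definition op_norm f : R := sup [set rnorm (f x) | x in [set x | `|x| <= 1]].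

Definition unitary_compact : set (H -> H) :=
  [set u | unitary_operator u /\
           exists2 K, compact_operator K & forall x, u x = x + K x].

Lemma rnormE x : (rnorm x)%:C = `|x|.
Proof.
have := normr_ge0 x; rewrite /rnorm; case: `|x| => a b /=.
by rewrite lecE /= => /andP[/eqP -> _].
Qed.

Lemma rnorm_ge0 x : 0 <= rnorm x.
Proof. by rewrite -lecR rnormE; exact: normr_ge0. Qed.

Lemma rnorm_le1 x : (rnorm x <= 1) = (`|x| <= 1).
Proof. by rewrite -lecR rnormE. Qed.

Lemma rnormD x y : rnorm (x + y) <= rnorm x + rnorm y.
Proof. by rewrite -lecR rmorphD /= !rnormE ler_normD. Qed.

Lemma rnormN x : rnorm (- x) = rnorm x.
Proof. by rewrite /rnorm normrN. Qed.

Lemma rnormZ (a : R) x : 0 <= a -> rnorm (a%:C *: x) = a * rnorm x.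
Proof.
move=> a0; suff: (rnorm (a%:C *: x))%:C = (a * rnorm x)%:C by case.
rewrite rmorphM /= !rnormE normrZ.
by rewrite ger0_norm // lecR.
Qed.

Lemma rnorm_eq0 x : rnorm x = 0 -> x = 0.
Proof. by move=> x0; apply/normr0_eq0; rewrite -rnormE x0. Qed.

Lemma unitary_norm u : unitary_operator u -> forall x, `|u x| = `|x|.
Proof.
move=> [_ uI _] x; apply/eqP.
by rewrite -(@eqrXn2 _ 2) // !inner_norm uI.
Qed.

Lemma unitary_rnorm u : unitary_operator u -> forall x, rnorm (u x) = rnorm x.
Proof. by move=> uU x; rewrite /rnorm unitary_norm. Qed.

Lemma linear_sub u x y : linear u -> u (x - y) = u x - u y.
Proof. by move=> lu; rewrite addrC -scaleN1r lu scaleN1r addrC. Qed.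

Lemma linear_scale u (a : R[i]) x : linear u -> u (a *: x) = a *: u x.
Proof.
move=> lu; have := lu 1 0 0; rewrite !scale1r addr0.
move=> /(congr1 (fun z => z - u 0)); rewrite addrK subrr => u0.
by have := lu a x 0; rewrite -u0 !addr0.
Qed.

Lemma unitary_inj u : unitary_operator u -> injective u.
Proof.
move=> uU x y uxy; apply/eqP; rewrite -subr_eq0 -normr_eq0.
rewrite -(unitary_norm uU) linear_sub; last by case: uU.
by rewrite uxy subrr normr0.
Qed.

Lemma unitary_continuous u : unitary_operator u -> continuous u.
Proof.
move=> uU x; apply/cvgrPdist_lt => e e0; near=> y.
rewrite -linear_sub; last by case: uU.
rewrite (unitary_norm uU); near: y; exact: cvgr_dist_lt.
Unshelve. all: by end_near. Qed.

Lemma compact_precompact (A B : set H) :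
  compact B -> A `<=` B -> precompact A.
Proof.
move=> cB AB; exists B => //; split=> //.
by apply: compact_closed => //; exact: norm_hausdorff.
Qed.

Lemma unitary1 : unitary_operator (@id H).
Proof. by split=> // y; exists y. Qed.

Lemma unitaryM u v :
  unitary_operator u -> unitary_operator v -> unitary_operator (u \o v).
Proof.
move=> [ul uI us] [vl vI vs]; split=> [a x y|x y|y] /=.
- by rewrite vl ul.
- by rewrite uI vI.
- by have [z <-] := us y; have [x <-] := vs z; exists x.
Qed.

Lemma unitaryV u v :
  unitary_operator u -> cancel v u -> unitary_operator v.
Proof.
move=> uU vK; have uI := unitary_inj uU; case: uU => [ul uD us].
split=> [a x y|x y|y].
- by apply: uI; rewrite ul !vK.
- by rewrite -uD !vK.
- by exists (u y); apply: uI; rewrite vK.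
Qed.

Lemma unitary_compact1 : unitary_compact id.
Proof.
split; first exact: unitary1.
exists (fun=> 0); last by move=> x; rewrite addr0.
split=> [a x y|]; first by rewrite scaler0 addr0.
by apply: (compact_precompact (@compact_set1 _ 0)) => _ [x _ <-].
Qed.

Lemma unitary_compactM u v :
  unitary_compact u -> unitary_compact v -> unitary_compact (u \o v).
Proof.
move=> [uU [K [Kl [A AK [cA _]]] uK]] [vU [L [Ll [B BL [cB _]]] vL]].
split; first exact: unitaryM.
exists (fun x => L x + K (v x)) => [|x]; last by rewrite /= uK vL addrA.
have [vl _ _] := vU.
split=> [a x y|].
  by rewrite Ll vl Kl scalerDr !addrA; congr (_ + _); rewrite addrAC.
have cBA : compact ((fun z : H * H => z.1 + z.2) @` (B `*` A)).
  apply: continuous_compact; last exact: compact_setX.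
  by apply: continuous_subspaceT => z; exact: add_continuous.
apply: (compact_precompact cBA) => _ [x x1 <-] /=.
exists (L x, K (v x)) => //; split=> /=; first by apply: BL; exists x.
by apply: AK; exists (v x) => //=; rewrite (unitary_norm vU).
Qed.

Lemma unitary_compactV u v :
  unitary_compact u -> cancel v u -> unitary_compact v.
Proof.
move=> [uU [K [Kl [A AK [cA _]]] uK]] vK.
have vU := unitaryV uU vK; split=> //.
have vu x : v (u x) = x by apply: (unitary_inj uU); rewrite vK.
have [vl _ _] := vU.
exists (fun x => - v (K x)) => [|x]; last first.
  have {1}<- : u x - K x = x by rewrite uK addrK.
  by rewrite linear_sub // vu.
split=> [a x y|]; first by rewrite Kl vl opprD scalerN.
have cA' : compact ((fun x => - v x) @` A).
  apply: continuous_compact => //; apply: continuous_subspaceT => x.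
  by apply: cvgN; exact: unitary_continuous.
apply: (compact_precompact cA') => _ [x x1 <-].
by exists (K x) => //; apply: AK; exists x.
Qed.

Definition bounded_op f := exists M, forall x, `|x| <= 1 -> rnorm (f x) <= M.

Lemma op_norm_ub f x : bounded_op f -> `|x| <= 1 -> rnorm (f x) <= op_norm f.
Proof.
move=> [M fM] x1; apply: ub_le_sup; last by exists x.
by exists M => _ [y y1 <-]; exact: fM.
Qed.

Lemma op_norm_le f M : (forall x, `|x| <= 1 -> rnorm (f x) <= M) ->
  op_norm f <= M.
Proof.
move=> fM; apply: ge_sup; last by move=> _ [x x1 <-]; exact: fM.
by exists (rnorm (f 0)); exists 0 => //=; rewrite normr0.
Qed.

Lemma unitary_bounded u v :
  unitary_operator u -> unitary_operator v -> bounded_op (fun x => u x - v x).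
Proof.
move=> uU vU; exists (1 + 1) => x; rewrite -rnorm_le1 => x1.
rewrite (le_trans (rnormD _ _)) // rnormN !unitary_rnorm //.
exact: lerD.
Qed.

End Operators.

(* The group of unitary operators of the form [id + K] with [K] compact, under
   composition, with the distance [op_norm (u - v)]. *)
Record UC (R : realType) (H : hilbertType R) := MkUC {
  UC_fun :> H -> H ;
  UC_subproof : UC_fun \in unitary_compact (H := H)
}.

HB.instance Definition _ R H := [isSub for @UC_fun R H].
HB.instance Definition _ R H := [Choice of @UC R H by <:].

Section UCGroup.
Variables (R : realType) (H : hilbertType R).
Implicit Types u v w : UC H.

Lemma UCP u : unitary_compact (u : H -> H).
Proof. exact/set_mem/UC_subproof. Qed.

Lemma UC_unitary u : unitary_operator (u : H -> H).
Proof. by case: (UCP u). Qed.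

Lemma UC_eq u v : (forall x, u x = v x) -> u = v.
Proof. by move=> uv; apply/val_inj/funext. Qed.

Lemma UC_surj u y : exists x, u x == y.
Proof. by have [_ _ /(_ y)[x <-]] := UC_unitary u; exists x. Qed.

Definition UC_invfun u (y : H) : H := xchoose (UC_surj u y).

Lemma UC_invfunK u : cancel (UC_invfun u) u.
Proof. by move=> y; exact/eqP/(xchooseP (UC_surj u y)). Qed.

Definition UC_one : UC H := MkUC (mem_set (unitary_compact1 H)).

Definition UC_mul u v : UC H :=
  MkUC (mem_set (unitary_compactM (UCP u) (UCP v))).

Definition UC_inv u : UC H :=
  MkUC (mem_set (unitary_compactV (UCP u) (@UC_invfunK u))).

Lemma UC_mulA : associative UC_mul.
Proof. by move=> u v w; apply: UC_eq. Qed.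

Lemma UC_mul1 : left_id UC_one UC_mul.
Proof. by move=> u; apply: UC_eq. Qed.

Lemma UC_mulr1 : right_id UC_one UC_mul.
Proof. by move=> u; apply: UC_eq. Qed.

Lemma UC_mulV : right_inverse UC_one UC_inv UC_mul.
Proof. by move=> u; apply: UC_eq => x; exact: UC_invfunK. Qed.

Lemma UC_mulVr : left_inverse UC_one UC_inv UC_mul.
Proof.
move=> u; apply: UC_eq => x; apply: (unitary_inj (UC_unitary u)).
exact: UC_invfunK.
Qed.

HB.instance Definition _ :=
  isGroup.Build (UC H) UC_mulA UC_mul1 UC_mulr1 UC_mulVr UC_mulV.

Definition UC_dist u v : R := op_norm (fun x => u x - v x).

Lemma UC_dist_ub u v x : rnorm x <= 1 -> rnorm (u x - v x) <= UC_dist u v.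
Proof.
rewrite rnorm_le1; apply: op_norm_ub.
by apply: unitary_bounded; exact: UC_unitary.
Qed.

Lemma UC_dist_le u v M :
  (forall x, rnorm x <= 1 -> rnorm (u x - v x) <= M) -> UC_dist u v <= M.
Proof. by move=> uvM; apply: op_norm_le => x; rewrite -rnorm_le1; exact: uvM. Qed.

Lemma UC_dist_ge0 u v : 0 <= UC_dist u v.
Proof.
apply: le_trans (UC_dist_ub u v (x := 0) _); first exact: rnorm_ge0.
by rewrite rnorm_le1 normr0.
Qed.

Lemma UC_distxx u : UC_dist u u = 0.
Proof.
apply/le_anti; rewrite UC_dist_ge0 andbT; apply: UC_dist_le => x _.
by rewrite subrr -lecR rnormE normr0.
Qed.

Lemma UC_dist_eq0 u v : UC_dist u v = 0 -> u = v.
Proof.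
move=> uv0; apply: UC_eq => x.
have [ul _ _] := UC_unitary u; have [vl _ _] := UC_unitary v.
have N0 : 0 < 1 + rnorm x by rewrite ltr_pwDl // rnorm_ge0.
pose a := (1 + rnorm x)^-1; have a0 : 0 < a by rewrite invr_gt0.
have x1 : rnorm (a%:C *: x) <= 1.
  by rewrite (rnormZ _ (ltW a0)) ler_pdivrMl // mulr1 lerDr.
have := UC_dist_ub u v x1; rewrite uv0 (linear_scale _ _ ul) (linear_scale _ _ vl) -scalerBr.
rewrite (rnormZ _ (ltW a0)) pmulr_rle0 // => d0.
apply/eqP; rewrite -subr_eq0; apply/eqP/rnorm_eq0/le_anti.
by rewrite d0 rnorm_ge0.
Qed.

Lemma UC_dist_sym u v : UC_dist u v = UC_dist v u.
Proof.
by apply/le_anti/andP; split; apply: UC_dist_le => x x1;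
  rewrite -rnormN opprB; exact: UC_dist_ub.
Qed.

Lemma UC_dist_triangle v u w : UC_dist u w <= UC_dist u v + UC_dist v w.
Proof.
apply: UC_dist_le => x x1; rewrite -(subrKA (v x)).
by rewrite (le_trans (rnormD _ _)) // lerD // UC_dist_ub.
Qed.

HB.instance Definition _ := isMetric.Build R (UC H)
  UC_distxx UC_dist_eq0 UC_dist_sym UC_dist_triangle.

Lemma UC_distM u v u' v' :
  UC_dist (u * v)%g (u' * v')%g <= UC_dist u u' + UC_dist v v'.
Proof.
apply: UC_dist_le => x x1; have [ul _ _] := UC_unitary u.
rewrite -(subrKA (u (v' x))) addrC (le_trans (rnormD _ _)) // lerD //.
  by apply: UC_dist_ub; rewrite (unitary_rnorm (UC_unitary v')).
have -> : (u * v)%g x - u (v' x) = u (v x - v' x) by rewrite linear_sub.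
by rewrite (unitary_rnorm (UC_unitary u)) UC_dist_ub.
Qed.

Lemma UC_distV u v : UC_dist (u^-1)%g (v^-1)%g <= UC_dist u v.
Proof.
apply: UC_dist_le => x x1; have [ul _ _] := UC_unitary u.
rewrite -(unitary_rnorm (UC_unitary u)) linear_sub //.
have -> : u ((u^-1)%g x) = v ((v^-1)%g x) by rewrite /= !UC_invfunK.
rewrite -rnormN opprB; apply: UC_dist_ub.
by rewrite (unitary_rnorm (UC_unitary (v^-1)%g)).
Qed.

Lemma UC_mulg_continuous : continuous (fun z : UC H * UC H => (z.1 * z.2)%g).
Proof.
move=> [u v]; apply/cvg_ballP => e e0.
have e2 : 0 < e / 2 by rewrite divr_gt0.
exists (ball u (e / 2), ball v (e / 2)); first by split; exact: nbhsx_ballx.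
move=> [u' v'] []; rewrite /= !ballEmdist /= => uu' vv'.
by rewrite (le_lt_trans (UC_distM _ _ _ _)) // (splitr e) ltrD.
Qed.

Lemma UC_invg_continuous : continuous (fun u : UC H => (u^-1)%g).
Proof.
move=> u; apply/(@cvg_ballP R _ _ (nbhs u) (nbhs_filter u)) => e e0; near=> v.
rewrite ballEmdist /=; apply: (le_lt_trans (UC_distV _ _)).
suff : ball u e v by rewrite ballEmdist.
by near: v; exact: nbhsx_ballx.
Unshelve. all: by end_near. Qed.

HB.instance Definition _ :=
  isTopologicalGroup.Build (UC H) UC_mulg_continuous UC_invg_continuous.

End UCGroup.

Section PropertyT.
Variable R : realType.

Record unitary_rep (G : topologicalGroupType) (H : hilbertType R) := UnitaryRep {
  rep :> G -> H -> H ;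
  rep_unitary : forall g, unitary_operator (rep g) ;
  rep_mul : forall g h x, rep (g * h)%g x = rep g (rep h x) ;
  rep_strongly_continuous : forall x, continuous (fun g => rep g x)
}.

Definition almost_invariant_vectors (G : topologicalGroupType)
    (H : hilbertType R) (pi : unitary_rep G H) :=
  forall (eps : R) (K : set G), 0 < eps -> compact K ->
    exists xi : H, `|xi| = 1 /\ forall g, K g -> `|xi - pi g xi| < eps%:C.

Definition invariant_unit_vector (G : topologicalGroupType)
    (H : hilbertType R) (pi : unitary_rep G H) :=
  exists xi : H, `|xi| = 1 /\ forall g, pi g xi = xi.

Definition property_T (G : topologicalGroupType) :=
  forall (H : hilbertType R) (pi : unitary_rep G H),
    almost_invariant_vectors pi -> invariant_unit_vector pi.

End PropertyT.

(* Main.v *)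
Require Import Defs.
From mathcomp Require Import all_boot all_order all_algebra.
From mathcomp Require Import complex finmap ring.
From mathcomp Require Import all_classical all_reals all_analysis.
From HB Require Import structures.

(** The tautological representation of [UC H] on [H] contradicts (T).
    A compact set of operators is covered by finitely many small balls around
    operators [u], and each [u - 1] maps the unit ball into a finite union of
    small balls around vectors [y].  As [H] is infinite-dimensional, some unit
    vector [x] is orthogonal to all the [u^-1 y - y], so that [u x - x] is
    orthogonal to every [y]; by Pythagoras it is no longer than its distance to
    the closest [y].  Hence there are almost invariant vectors, whereas a unit
    vector [xi] is moved by the reflection [x - 2 <x, xi> xi], a rank-one
    perturbation of the identity. *)

Set Implicit Arguments.
Unset Strict Implicit.
Unset Printing Implicit Defensive.

Import Order.TTheory GRing.Theory Num.Theory.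
Import numFieldNormedType.Exports.

Local Open Scope classical_set_scope.
Local Open Scope ring_scope.
Local Open Scope complex_scope.

(** The field is generic because nets are taken both among vectors, with radii in [R[i]], and among
    operators, with radii in [R]. *)
Lemma compact_net (K : numFieldType) (T : pseudoPMetricType K) (A : set T)
    (e : K) : compact A -> 0 < e ->
  exists s : seq T, forall x, A x -> exists2 y, y \in s & ball y e x.
Proof.
rewrite compact_cover => cA e0.
have [||D _ AD] := cA T setT (fun y => (ball y e)^°).
- by move=> y _; exact: open_interior.
- by move=> x _; exists x => //; exact: nbhsx_ballx.
- by exists (enum_fset D) => x /AD[y yD /interior_subset yx]; exists y.
Qed.

Lemma complex_gt0_real (R : realType) (e : R[i]) :
  0 < e -> exists2 r : R, 0 < r & e = r%:C.
Proof.
case: e => a b; rewrite ltcE /= => /andP[/eqP -> a0].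
by exists a.
Qed.

Section Geometry.
Variables (R : realType) (H : hilbertType R).
Implicit Types x y z xi : H.

Lemma ball_lipschitz_continuous (T : pseudoMetricType R) (f : T -> H) (M : R) :
  0 <= M -> (forall s t d, ball s d t -> `|f s - f t| <= (d * M)%:C) ->
  continuous f.
Proof.
move=> M0 fM s; apply/cvgrPdist_lt => _ /complex_gt0_real[r r0 ->].
(* Dividing by [1 + M] rather than [M] covers the case [M = 0]. *)
have M1 : 0 < 1 + M by rewrite ltr_pwDl.
near=> t; apply: le_lt_trans (fM s t (r / (1 + M)) _) _.
  by near: t; apply: nbhsx_ballx; rewrite divr_gt0.
by rewrite ltcR mulrAC ltr_pdivrMr // ltr_pM2l // ltrDr.
Unshelve. all: by end_near. Qed.

Lemma scale_real_continuous x : continuous (fun a : R => a%:C *: x).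
Proof.
apply: (ball_lipschitz_continuous (rnorm_ge0 x)) => a b d.
rewrite -ball_normE /= => abd.
rewrite -scalerBl normrZ -rmorphB normc_def /= expr0n addr0 sqrtr_sqr -rnormE.
by rewrite -rmorphM lecR ler_wpM2r ?rnorm_ge0 // ltW.
Qed.

Lemma inner_conj x y : inner x y = ((inner y x)^*)%R.
Proof. by rewrite hermC expr0 mul1r. Qed.

Lemma inner_linear_left (a : R[i]) x y z :
  inner (a *: x + y) z = a * inner x z + inner y z.
Proof. by rewrite linearDl linearZl_LR. Qed.

(** Pythagoras: the squared norm on the right exceeds the one on the left by [|y| ^+ 2]. *)
Lemma orthogonal_norm_leB x y : inner x y = 0 -> `|x| <= `|x - y|.
Proof.
move=> xy0; rewrite -(@ler_pXn2r _ 2) // ?nnegrE// !inner_norm.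
rewrite linearBl !linearBr /= xy0 (inner_conj y x) xy0 conjC0 subr0 sub0r opprK.
by rewrite lerDl -inner_norm exprn_ge0.
Qed.

(** Cauchy-Schwarz: the projection [c *: y] of [x] is orthogonal to [c *: y - x], so Pythagoras
    makes it no longer than [x]. *)
Lemma norm_inner_le x y : `|y| = 1 -> `|inner x y| <= `|x|.
Proof.
move=> y1; set c := inner x y.
have cyx : inner (c *: y) (c *: y - x) = 0.
  rewrite linearZl_LR linearBr linearZr_LR /= -inner_norm y1 (inner_conj y x).
  by rewrite expr1n mulr1 subrr mulr0.
have := orthogonal_norm_leB cyx.
by rewrite normrZ y1 mulr1 opprB addrC subrK.
Qed.

(** Each further condition [inner x z = 0] lowers the dimension by at most one: either it already
    follows from the others, or adding a single [v] that violates it to a generating family restores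
    what was lost. *)
Lemma orthogonal_not_finitely_generated (s : seq H) :
  infinite_dimensional H ->
  ~ exists (n : nat) (e : 'I_n -> H), forall x,
      (forall z, z \in s -> inner x z = 0) ->
      exists c : 'I_n -> R[i], x = \sum_(i < n) c i *: e i.
Proof.
move=> Hinf; elim: s => [|z s IHs] [n [e eP]].
  by apply: Hinf; exists n, e => x; exact: eP.
have eP' x : (forall w, w \in s -> inner x w = 0) -> inner x z = 0 ->
    exists c : 'I_n -> R[i], x = \sum_(i < n) c i *: e i.
  by move=> xs xz; apply: eP => w; rewrite inE => /predU1P[->//|/xs].
apply: IHs.
have [[v vs vz]|nv] := pselect (exists2 v : H,
    forall w, w \in s -> inner v w = 0 & inner v z != 0); last first.
  exists n, e => x xs; apply: eP' => //; apply/eqP.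
  by apply: contra_notT nv => xz; exists x.
exists n.+1, (fun i => oapp e v (unlift ord0 i)) => x xs.
(* This coefficient makes [x - a *: v] orthogonal to [z]. *)
pose a := inner x z / inner v z.
have [w ws||c cE] := eP' (x - a *: v).
- by rewrite linearBl linearZl_LR /= xs // vs // mulr0 subrr.
- by rewrite linearBl linearZl_LR /= divfK // subrr.
exists (fun i => oapp c a (unlift ord0 i)).
rewrite big_ord_recl unlift_none /=; apply/eqP; rewrite addrC -subr_eq.
by rewrite cE; apply/eqP/eq_bigr => i _; rewrite liftK.
Qed.

Lemma exists_unit_orthogonal (s : seq H) : infinite_dimensional H ->
  exists x, `|x| = 1 /\ forall z, z \in s -> inner x z = 0.
Proof.
move=> /(orthogonal_not_finitely_generated (s := s)) Hs.
have [x xs x0] : exists2 x, forall z, z \in s -> inner x z = 0 & x != 0.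
  (* Otherwise the orthogonal complement would be zero, generated by the empty family. *)
  apply: contrapT => nx; apply: Hs; exists 0, (fun=> 0) => x xs.
  exists (fun=> 0); rewrite big_ord0; apply/eqP.
  by apply: contra_notT nx => x0; exists x.
exists (`|x|^-1 *: x); split.
  by rewrite normrZ normfV normr_id mulVf // normr_eq0.
by move=> z zs; rewrite linearZl_LR /= xs // mulr0.
Qed.

Definition reflection (xi x : H) : H := x - (2 * inner x xi) *: xi.

Lemma reflectionK xi : `|xi| = 1 -> involutive (reflection xi).
Proof.
move=> xi1 x; rewrite /reflection linearBl linearZl_LR /=.
rewrite -(inner_norm xi) xi1 expr1n mulr1.
have -> : 2 * (inner x xi - 2 * inner x xi) = - (2 * inner x xi) by ring.
by rewrite scaleNr opprK subrK.
Qed.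

Lemma reflection_self xi : `|xi| = 1 -> reflection xi xi = - xi.
Proof.
move=> xi1; rewrite /reflection -inner_norm xi1 expr1n mulr1.
by rewrite scaler_nat mulr2n opprD addNKr.
Qed.

Lemma reflection_unitary xi : `|xi| = 1 -> unitary_operator (reflection xi).
Proof.
move=> xi1; split=> [a x y|x y|y]; last first.
- by exists (reflection xi y); rewrite reflectionK.
- have sesqui (a b : R[i]) : inner (x - a *: xi) (y - b *: xi) =
      inner x y - b^*%R * inner x xi - a * (inner xi y - b^*%R).
    rewrite linearBl !linearBr !linearZl_LR /= !linearZr_LR /=.
    by rewrite -(inner_norm xi) xi1 expr1n mulr1 [_ *: a]mulrC.
  rewrite sesqui (inner_conj xi y) rmorphM rmorph_nat; ring.
- rewrite /reflection inner_linear_left scalerBr mulrDr scalerDl opprD.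
  by rewrite scalerA mulrCA addrACA.
Qed.

(** Real coordinates reduce compactness to that of segments; the set will contain the image of the
    unit ball under a rank-one operator. *)
Lemma scale_square_compact xi (M : R) :
  compact ((fun p : R * R => (p.1 +i* p.2) *: xi) @`
    (`[- M, M]%classic `*` `[- M, M]%classic)).
Proof.
apply: continuous_compact; last by apply: compact_setX; exact: segment_compact.
apply: continuous_subspaceT => p.
rewrite (_ : (fun p : R * R => _) =
    fun p => (p.1)%:C *: xi + (p.2)%:C *: ('i *: xi)); last first.
  apply/funext => q; rewrite scalerA -scalerDl; congr (_ *: _).
  by rewrite [LHS]complexE mulrC.
apply: cvgD.
  exact: (continuous_comp (@cvg_fst _ _ _ _ _) (@scale_real_continuous xi p.1)).
exact: (continuous_comp (@cvg_snd _ _ _ _ _)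
  (@scale_real_continuous ('i *: xi) p.2)).
Qed.

Lemma reflection_unitary_compact xi :
  `|xi| = 1 -> unitary_compact (reflection xi).
Proof.
move=> xi1; split; first exact: reflection_unitary.
exists (fun x => - (2 * inner x xi) *: xi); last first.
  by move=> x; rewrite scaleNr.
split=> [a x y|].
  by rewrite inner_linear_left mulrDr opprD scalerDl mulrCA -mulrN scalerA.
(* By Cauchy-Schwarz the coefficient has modulus at most 2 on the unit ball, hence so do its real
   and imaginary parts. *)
apply: (Defs.compact_precompact (@scale_square_compact xi 2)) => _ [x x1 <-].
set z := - (2 * inner x xi).
have z2 : `|z| <= 2%:C.
  rewrite normrN normrM normr_nat rmorph_nat ler_piMr //.
  by rewrite (le_trans (norm_inner_le x xi1)).
exists (complex.Re z, complex.Im z); last by rewrite /=; case: (z).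
split; rewrite /= in_itv /= -ler_norml -lecR; apply: le_trans z2.
  exact: normc_ge_Re.
by rewrite normc_def lecR -sqrtr_sqr ler_wsqrtr // lerDr sqr_ge0.
Qed.

End Geometry.

(** A base point is what [compact_net] requires of [UC H]. *)
HB.instance Definition _ (R : realType) (H : hilbertType R) :=
  isPointed.Build (UC H) (@UC_one R H).

Section Tautological.
Variables (R : realType) (H : hilbertType R).
Implicit Types u v g : UC H.

Lemma UC_orthogonal_small u (e : R[i]) : 0 < e ->
  exists s : seq H, forall x, `|x| <= 1 ->
    (forall z, z \in s -> inner x z = 0) -> `|x - u x| < e.
Proof.
move=> e0; have [[_ uI _] [K [_ +] uE]] := UCP u.
rewrite precompactE => /compact_net-/(_ e e0)[s sP].
(* The adjoint of [u - 1] applied to [y], the adjoint of [u] being [u^-1]: orthogonality of [x] to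
   it is that of [K x] to [y]. *)
exists [seq (u^-1)%g y - y | y <- s] => x x1 xs.
have [|y ys] := sP (K x); first by apply: subset_closure; exists x.
have -> : x - u x = - K x by rewrite uE opprD addrA subrr sub0r.
rewrite normrN -ball_normE /= distrC; apply: le_lt_trans.
apply: orthogonal_norm_leB.
have -> : K x = u x - x by rewrite uE addrC addKr.
have <- := xs _ (map_f _ ys).
by rewrite linearBl linearBr /= -(uI x (UC_invfun u y)) UC_invfunK.
Qed.

(** The operator norm only tests the unit ball, so a nonzero [x] is normalised first. *)
Lemma UC_dist_norm u v (x : H) : `|u x - v x| <= (UC_dist u v)%:C * `|x|.
Proof.
have [ul _ _] := UC_unitary u; have [vl _ _] := UC_unitary v.
have [->|x0] := eqVneq x 0.
  have := linear_scale 0 0 ul; have := linear_scale 0 0 vl.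
  by rewrite !scale0r => -> ->; rewrite subr0 normr0 mulr0.
have n0 : 0 < `|x| by rewrite normr_gt0.
rewrite -ler_pdivrMr // mulrC -[X in X * _]ger0_norm ?invr_ge0 ?(ltW n0)//.
rewrite -normrZ scalerBr -(linear_scale _ _ ul) -(linear_scale _ _ vl) -[leLHS]rnormE lecR; apply: UC_dist_ub.
by rewrite rnorm_le1 normrZ normfV normr_id mulVf // gt_eqF.
Qed.

Lemma UC_strongly_continuous (x : H) : continuous (fun g : UC H => g x).
Proof.
apply: (ball_lipschitz_continuous (rnorm_ge0 x)) => u v d.
rewrite ballEmdist /= => uvd; apply: le_trans (UC_dist_norm _ _ _) _.
by rewrite -rnormE -rmorphM lecR ler_wpM2r ?rnorm_ge0 // ltW.
Qed.

Definition UC_tautological : unitary_rep (UC H) H :=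
  {| rep := fun g x => g x;
     rep_unitary := @UC_unitary R H;
     rep_mul := fun _ _ _ => erefl;
     rep_strongly_continuous := UC_strongly_continuous |}.

Lemma UC_tautological_almost_invariant :
  infinite_dimensional H -> almost_invariant_vectors UC_tautological.
Proof.
move=> Hinf e K e0 cK; have e20 : 0 < e / 2 by rewrite divr_gt0.
have [s sP] := compact_net cK e20.
have e2C : 0 < (e / 2)%:C :> R[i] by rewrite ltcR.
have [t tP] := choice (fun u => UC_orthogonal_small u e2C).
(* One vector serves every operator [u] of the net, since the lists [t u] together are still
   finite. *)
have [x [x1 xt]] := exists_unit_orthogonal (flatten (map t s)) Hinf.
exists x; split=> // g /sP[u us]; rewrite ballEmdist /= => ug.
(* Half of [e] pays for [u] moving [x], the other half for replacing [u] by [g]. *)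
rewrite -(subrKA (u x)) (splitr e) rmorphD.
apply: le_lt_trans (ler_normD _ _) _; apply: ltrD.
  apply: tP => [|z zt]; first by rewrite x1.
  by apply: xt; apply/flatten_mapP; exists u.
apply: le_lt_trans (UC_dist_norm _ _ _) _.
by rewrite x1 mulr1 ltcR.
Qed.

Lemma UC_tautological_no_invariant : ~ invariant_unit_vector UC_tautological.
Proof.
move=> [xi [xi1 /(_ (MkUC (mem_set (reflection_unitary_compact xi1))))]] /=.
rewrite reflection_self // => /eqP; rewrite eq_sym -addr_eq0 -mulr2n.
rewrite -scaler_nat scaler_eq0 pnatr_eq0 /= -normr_eq0 xi1.
by rewrite oner_eq0.
Qed.

End Tautological.

Theorem mainTheorem9 (R : realType) (H : hilbertType R)
    (Hsep : separable_space H) (Hinf : infinite_dimensional H) :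
  ~ property_T R (UC H).
Proof.
move=> /(_ H (UC_tautological H)) HT.
apply: (@UC_tautological_no_invariant R H); apply: HT.
exact: UC_tautological_almost_invariant.
Qed.
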